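(* Let $X,Y$ be Banach spaces and let $T\in B(X,Y)$ be such that $\mathcal N(T)$ and $\mathcal R(T)$ are Chebyshev subspaces of $X$ and $Y$, respectively, with Moore--Penrose metric generalized inverse $T^M$. Let $\delta T\in B(X,Y)$ be such that $T^M$ is quasi-additive on $\mathcal R(\delta T)$ and $\|T^M\delta T\|<1$. Put $\bar T=T+\delta T$, let $b\in\mathcal R(T)$ with $b\neq0$, and let $\delta b\in Y$ be such that $\bar b=b+\delta b\in\mathcal R(\bar T)$. Let $S(T,b)=\{x\in X:Tx=b\}$, $S(\bar T,\bar b)=\{z\in X:\bar Tz=\bar b\}$, and put $\kappa=\|T^M\|\,\|T\|$, $\epsilon_b=\|\delta b\|/\|b\|$, $\epsilon_T=\|\delta T\|/\|T\|$. If $T^M$ is quasi-additive on $\mathcal R(T)$, then for any $z\in S(\bar T,\bar b)$ there exists $x\in S(T,b)$ such that $$\frac{1}{1+\|T^M\delta T\|}\left(\frac{\|T^M\delta b\|}{\|T^Mb\|+2\|z\|}-\kappa\,\epsilon_T\right)\le\frac{\|z-x\|}{\|x\|}\le\frac{\kappa(\epsilon_b+\epsilon_T)}{1-\|T^M\delta T\|}.$$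
   Context: $B(X,Y)$ is the space of bounded linear operators from $X$ to $Y$; $\mathcal N(\cdot)$ and $\mathcal R(\cdot)$ denote null space and range. A bounded homogeneous operator $A:Y\to X$ is a map sending bounded sets to bounded sets with $A(\lambda y)=\lambda A(y)$ for all $y\in Y$, $\lambda\in\mathbb R$; its norm is $\|A\|=\sup\{\|Ay\|:\|y\|=1\}$. A map $A:Y\to X$ is quasi-additive on $M\subset Y$ if $A(y+z)=A(y)+A(z)$ for all $y\in Y$, $z\in M$. A subspace $G$ of a Banach space $Z$ is Chebyshev if each $z\in Z$ has exactly one nearest point in $G$, denoted $\pi_G(z)$; $\pi_G$ is the metric projector onto $G$. For $T\in B(X,Y)$ with $\mathcal N(T)$, $\mathcal R(T)$ Chebyshev, the Moore--Penrose metric generalized inverse of $T$ is the (existing and unique) bounded homogeneous operator $T^M:Y\to X$ with $TT^MT=T$, $T^MTT^M=T^M$, $T^MT=I_X-\pi_{\mathcal N(T)}$, $TT^M=\pi_{\mathcal R(T)}$. Products of operators denote composition; since $T^M$ is quasi-additive on $\mathcal R(\delta T)$, $T^M\delta T$ is a bounded linear operator on $X$. *)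

(* Defs.v *)
From mathcomp Require Import all_boot all_order all_algebra.
From mathcomp Require Import boolp classical_sets functions reals.
From mathcomp Require Import topology normedtype sequences.

Set Implicit Arguments.
Unset Strict Implicit.
Unset Printing Implicit Defensive.

Import Order.TTheory GRing.Theory Num.Theory.
Import numFieldNormedType.Exports.

Local Open Scope classical_set_scope.
Local Open Scope ring_scope.

Section Operators.
Context {R : realType} {V W : normedModType R}.

Definition bounded_homogeneous (A : V -> W) := bounded_fun_norm A /\ scalable A.

(* [sup] is real-valued, and equal to 0 on sets that are empty or unbounded;
   the set below is bounded as soon as [A] is bounded in the sense of
   [bounded_fun_norm], and it is empty only when [V] is the zero space. *)
Definition opnorm (A : V -> W) : R := sup [set `|A v| | v in [set v | `|v| = 1]].

Definition quasi_additive_on (M : set V) (A : V -> W) :=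
  forall y z, M z -> A (y + z) = A y + A z.

Definition nullspace (A : V -> W) : set V := A @^-1` [set 0].

Definition solutions (A : V -> W) (b : W) : set V := [set v | A v = b].

End Operators.

Section Chebyshev.
Context {R : realType} {Z : normedModType R}.

Definition subspace (G : set Z) :=
  G 0 /\ forall (a : R) (u v : Z), G u -> G v -> G (a *: u + v).

Definition nearest_point (G : set Z) (z g : Z) :=
  G g /\ forall h, G h -> `|z - g| <= `|z - h|.

Definition chebyshev (G : set Z) :=
  subspace G /\ forall z, exists! g, nearest_point G z g.

(* The default value 0 is irrelevant when [G] is Chebyshev. *)
Definition metric_projector (G : set Z) (z : Z) : Z := xget 0 (nearest_point G z).

End Chebyshev.

Definition metric_ginv {R : realType} {X Y : normedModType R}
    (T : X -> Y) (TM : Y -> X) :=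
  [/\ bounded_homogeneous TM,
      T \o TM \o T =1 T,
      TM \o T \o TM =1 TM,
      (forall x, TM (T x) = x - metric_projector (nullspace T) x) &
      T \o TM =1 metric_projector (range T)].

(* Main.v *)
(* For [z] with [(T + dT) z = b + db], take [x = TM b + p], where [p] is the
   projection of [z] onto the kernel of [T]. Writing [T z = (db - dT z) + b] and
   using quasi-additivity on the ranges of [T] and [dT] gives
   [z - x = TM db - A z], where [A = TM o dT] is additive; hence
   [(z - x) + A (z - x) = TM db - A x]. Both estimates are the triangle
   inequality for this identity, combined with
   [|b| / |T| <= |x| <= |TM b| + 2 |z|]. *)
Require Import Defs.
From mathcomp Require Import all_boot all_order all_algebra.
From mathcomp Require Import boolp classical_sets functions reals.
From mathcomp Require Import topology normedtype sequences.
From mathcomp Require Import lra.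
Import Order.TTheory GRing.Theory Num.Theory.
Import numFieldNormedType.Exports.
Local Open Scope classical_set_scope.
Local Open Scope ring_scope.

Lemma opnorm_ge0 {R : realType} {V W : normedModType R} (A : V -> W) :
  0 <= opnorm A.
Proof.
rewrite /opnorm; set S := (X in sup X).
(* Without a supremum, [sup] takes its default value 0; otherwise it dominates some norm in the
   set. *)
have [supS|/sup_out -> //] := pselect (has_sup S).
have [[r Sr] _] := supS.
have := sup_upper_bound supS Sr; apply: le_trans.
by case: Sr => v _ <-.
Qed.

Lemma le_opnorm {R : realType} {V W : normedModType R} {A : V -> W} v :
  bounded_homogeneous A -> `|A v| <= opnorm A * `|v|.
Proof.
move=> [Abnd Ahom].
have [->|v0] := eqVneq v 0.
  have -> : A 0 = 0 by rewrite -(scale0r 0) Ahom scale0r.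
  by rewrite !normr0 mulr0.
have nv0 : 0 < `|v| by rewrite normr_gt0.
have unit_norm : `| `|v|^-1 *: v| = 1.
  by rewrite normrZ normfV normr_id mulVf ?gt_eqF.
rewrite -ler_pdivrMr // mulrC.
have -> : `|v|^-1 * `|A v| = `|A (`|v|^-1 *: v)|.
  by rewrite Ahom normrZ normfV normr_id.
(* Boundedness on the unit ball bounds the set of values above, so [opnorm A] is a true supremum and
   not the default 0. *)
have [M AM] := Abnd 1.
apply: ub_le_sup; last by exists (`|v|^-1 *: v).
by exists M => _ [w /= w1 <-]; apply: AM; rewrite w1.
Qed.

Lemma bounded_homogeneous_linear {R : realType} {V W : normedModType R}
    {A : {linear V -> W}} :
  bounded_fun_norm A -> bounded_homogeneous A.
Proof. by move=> Abnd; split=> // a u; rewrite linearZ. Qed.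

Lemma bounded_homogeneous_comp {R : realType} {U V W : normedModType R}
    {A : V -> W} {B : U -> V} :
  bounded_homogeneous A -> bounded_homogeneous B ->
  bounded_homogeneous (A \o B).
Proof.
move=> [Abnd Ahom] [Bbnd Bhom]; split; last by move=> a u /=; rewrite Bhom Ahom.
move=> r; have [M BM] := Bbnd r; have [N AN] := Abnd M.
by exists N => u ur; apply: AN; apply: BM.
Qed.

Lemma metric_projectorP {R : realType} {Z : normedModType R} {G : set Z} z :
  chebyshev G -> nearest_point G z (metric_projector G z).
Proof. by move=> [_ /(_ z) [g [gP _]]]; apply: (xgetPex 0); exists g. Qed.

(** Since 0 lies in [G], the distance from [z] to its projection is at most the norm of [z]; the
    triangle inequality adds a second such term. *)
Lemma norm_metric_projector_le {R : realType} {Z : normedModType R}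
    {G : set Z} z :
  chebyshev G -> `|metric_projector G z| <= 2 * `|z|.
Proof.
move=> Gcheb; have [_ /(_ 0 Gcheb.1.1)] := metric_projectorP z Gcheb.
rewrite subr0 => dist_le.
have -> : metric_projector G z = z - (z - metric_projector G z).
  by rewrite subKr.
by rewrite (le_trans (ler_normB _ _))// mulr_natl mulr2n lerD2l.
Qed.

Theorem theorem4p2 (R : realType) (X Y : completeNormedModType R)
    (T dT : {linear X -> Y}) (TM : Y -> X) (b db : Y)
    (T_bounded : bounded_fun_norm T)
    (kerT_chebyshev : chebyshev (nullspace T))
    (ranT_chebyshev : chebyshev (range T))
    (TM_ginv : metric_ginv T TM)
    (dT_bounded : bounded_fun_norm dT)
    (TM_qadd_dT : quasi_additive_on (range dT) TM)
    (TMdT_lt1 : opnorm (TM \o dT) < 1)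
    (b_ran : range T b) (b_neq0 : b <> 0)
    (bbar_ran : range (T \+ dT) (b + db))
    (TM_qadd_T : quasi_additive_on (range T) TM) :
  let kappa := opnorm TM * opnorm T in
  let eps_b := `|db| / `|b| in
  let eps_T := opnorm dT / opnorm T in
  forall z, solutions (T \+ dT) (b + db) z ->
  exists x, solutions T b x /\
    1 / (1 + opnorm (TM \o dT)) *
      (`|TM db| / (`|TM b| + 2 * `|z|) - kappa * eps_T)
      <= `|z - x| / `|x|
      <= kappa * (eps_b + eps_T) / (1 - opnorm (TM \o dT)).
Proof.
move=> kappa eps_b eps_T z zP.
have [TMbh TTMT _ TMT _] := TM_ginv.
set A := TM \o dT.
have Tbh := bounded_homogeneous_linear T_bounded.
have dTbh := bounded_homogeneous_linear dT_bounded.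
have Abh : bounded_homogeneous A by exact: bounded_homogeneous_comp.
have AD u v : A (u + v) = A u + A v.
  by rewrite /A /= linearD TM_qadd_dT//; exists v.
have AN u : A (- u) = - A u by rewrite -scaleN1r Abh.2 scaleN1r.
pose x := TM b + metric_projector (nullspace T) z.
have Tx : T x = b.
  have [Tp0 _] := metric_projectorP z kerT_chebyshev.
  by rewrite /x linearD Tp0 addr0; case: b_ran => u _ <-; exact: TTMT.
have zxE : z - x = TM db - A z.
  (* Quasi-additivity splits off only a right summand, so [b] in [range T] comes last and [dT (- z)]
     in [range dT] just before it, while [db] stays on the left. *)
  have TzE : T z = (db + dT (- z)) + b.
    have /(canRL (addrK _)) -> : T z + dT z = b + db by [].
    by rewrite linearN [RHS]addrC addrA.
  rewrite /x opprD [- _ - _]addrC addrA -TMT TzE TM_qadd_T// addrK.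
  by rewrite TM_qadd_dT; [rewrite -[TM (dT _)]/(A (- z)) AN | exists (- z)].
have residual : (z - x) + A (z - x) = TM db - A x.
  by rewrite AD AN {1}zxE addrA subrK.
have nb0 : 0 < `|b| by rewrite normr_gt0; apply/eqP.
have nbT : `|b| <= opnorm T * `|x| by rewrite -Tx le_opnorm.
have nx0 : 0 < `|x|.
  rewrite normr_gt0; apply/eqP => x0.
  by move: nbT; rewrite x0 normr0 mulr0 leNgt nb0.
(* As [b] is nonzero, [nbT] makes both of its factors positive, so the quotients by [|x|] and
   [opnorm T] are genuine. *)
have nT0 : 0 < opnorm T by move: (lt_le_trans nb0 nbT); rewrite pmulr_lgt0.
have nA0 : 0 <= opnorm A by exact: opnorm_ge0.
have nTM0 : 0 <= opnorm TM by exact: opnorm_ge0.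
have nAx : `|A x| <= opnorm TM * opnorm dT * `|x|.
  rewrite (le_trans (le_opnorm _ TMbh))// -mulrA ler_wpM2l//.
  exact: le_opnorm.
have nAzx := le_opnorm (z - x) Abh.
have kappa_eps_T : kappa * eps_T = opnorm TM * opnorm dT.
  by rewrite /kappa /eps_T -mulrA [opnorm T * _]mulrC divfK ?gt_eqF.
exists x; split; first exact: Tx.
apply/andP; split.
- have nx_le : `|x| <= `|TM b| + 2 * `|z|.
    by rewrite (le_trans (ler_normD _ _))// lerD2l norm_metric_projector_le.
  have den0 : 0 < 1 + opnorm A by rewrite ltr_wpDr.
  rewrite div1r mulrC ler_pdivrMr// kappa_eps_T.
  (* By [nx_le], putting [|x|] in the denominator only enlarges the quotient. *)
  apply: (@le_trans _ _ (`|TM db| / `|x| - opnorm TM * opnorm dT)).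
    rewrite lerD2r ler_wpM2l// lef_pV2 ?posrE//.
    exact: lt_le_trans nx_le.
  rewrite mulrAC ler_pdivlMr// mulrBl divfK ?gt_eqF//.
  have : `|TM db - A x| <= `|z - x| + `|A (z - x)|.
    by rewrite -residual ler_normD.
  by have := lerB_dist (TM db) (A x); lra.
- have den0 : 0 < 1 - opnorm A by rewrite subr_gt0.
  rewrite ler_pdivrMr// mulrAC ler_pdivlMr// [kappa * _]mulrDr mulrDl kappa_eps_T.
  (* The bound [opnorm TM * |db|] is multiplied by [opnorm T * |x| / |b|], which is at least 1 by
     [nbT]. *)
  have TMdb_le : `|TM db| <= kappa * eps_b * `|x|.
    rewrite (le_trans (le_opnorm _ TMbh))// /kappa /eps_b -!mulrA ler_wpM2l//.
    rewrite mulrCA -[leLHS]mulr1 ler_wpM2l// mulrCA.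
    by rewrite ler_pdivlMl// mulr1.
  have : `|z - x| <= `|TM db - A x| + `|A (z - x)|.
    by rewrite -residual -{1}(addrK (A (z - x)) (z - x)) ler_normB.
  by have := ler_normB (TM db) (A x); lra.
Qed.
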